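(* Let $C\ge 1$ and let $\mathcal{D}_1,\dots,\mathcal{D}_C$ be $C$ datasets, and let $p(\mathbf{w}\mid\mathcal{D}_c)$, $c=1,\dots,C$, be the posteriors of the same parametric model with parameters $\mathbf{w}$. Assume that (i) the datasets are conditionally independent given the model, i.e. $p(\mathcal{D}_1,\dots,\mathcal{D}_C\mid\mathbf{w})=\prod_{c=1}^C p(\mathcal{D}_c\mid\mathbf{w})$, and (ii) the prior $p(\mathbf{w})$ is the same across clients (and is also the prior used for the global posterior). Then there is a normalizing constant $\alpha$, not depending on $\mathbf{w}$, such that for every $\mathbf{w}$ with $p(\mathbf{w})>0$ the global posterior can be written as $$p(\mathbf{w}\mid\mathcal{D}_1,\dots,\mathcal{D}_C)=\alpha\cdot\frac{\prod_{c=1}^C p(\mathbf{w}\mid\mathcal{D}_c)}{p(\mathbf{w})^{C-1}}.$$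
   Context: There are $C$ clients; client $c$ holds a dataset $\mathcal{D}_c$. All clients use the same parametric probabilistic model, with parameter vector $\mathbf{w}$ ranging over a parameter space. $p(\mathbf{w})$ denotes the prior density of $\mathbf{w}$; $p(\mathcal{D}_c\mid\mathbf{w})$ is the likelihood of $\mathcal{D}_c$ and $p(\mathcal{D}_1,\dots,\mathcal{D}_C\mid\mathbf{w})$ the joint likelihood of all the datasets. The marginal likelihoods are $p(\mathcal{D}_c)=\int p(\mathcal{D}_c\mid\mathbf{w})\,p(\mathbf{w})\,d\mathbf{w}$ and $p(\mathcal{D}_1,\dots,\mathcal{D}_C)=\int p(\mathcal{D}_1,\dots,\mathcal{D}_C\mid\mathbf{w})\,p(\mathbf{w})\,d\mathbf{w}$, all taken to be positive and finite for the fixed observed datasets so that posteriors are defined. The local posterior of client $c$ is given by Bayes' theorem, $p(\mathbf{w}\mid\mathcal{D}_c)=p(\mathcal{D}_c\mid\mathbf{w})\,p(\mathbf{w})/p(\mathcal{D}_c)$, and the global posterior is $p(\mathbf{w}\mid\mathcal{D}_1,\dots,\mathcal{D}_C)=p(\mathcal{D}_1,\dots,\mathcal{D}_C\mid\mathbf{w})\,p(\mathbf{w})/p(\mathcal{D}_1,\dots,\mathcal{D}_C)$. *)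

(* Defs.v *)
From HB Require Import structures.
From mathcomp Require Import all_boot all_order all_algebra.
From mathcomp Require Import all_classical all_reals all_analysis.

Set Implicit Arguments.
Unset Strict Implicit.
Unset Printing Implicit Defensive.

Import Order.TTheory GRing.Theory Num.Theory.
Import numFieldNormedType.Exports.

Local Open Scope classical_set_scope.
Local Open Scope ring_scope.

(* The parameter space is a measurable space W with a reference measure mu
   (the "dw" of the integrals, e.g. Lebesgue measure). A likelihood
   [lik : W -> R] is the map w |-> p(D | w) for a fixed observed D. *)

Definition is_density d (W : measurableType d) (R : realType)
    (mu : {measure set W -> \bar R}) (f : W -> R) : Prop :=
  [/\ measurable_fun setT f,
      forall w, 0 <= f w &
      (\int[mu]_w (f w)%:E = 1)%E].

Definition marginal_likelihood d (W : measurableType d) (R : realType)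
    (mu : {measure set W -> \bar R}) (prior lik : W -> R) : \bar R :=
  (\int[mu]_w (lik w * prior w)%:E)%E.

(* [fine] is only meaningful on a finite marginal likelihood. *)
Definition posterior d (W : measurableType d) (R : realType)
    (mu : {measure set W -> \bar R}) (prior lik : W -> R) (w : W) : R :=
  lik w * prior w / fine (marginal_likelihood mu prior lik).

(* Main.v *)
(* Each local posterior carries one factor prior / Z_c, with Z_c its marginal
   likelihood, so dividing their product by prior ^ (C - 1) leaves the single
   prior factor of the global posterior, and alpha = (\prod_c Z_c) / Z with Z
   the joint marginal likelihood. Restricting the integral to {prior > 0} loses
   no mass because a posterior vanishes wherever its prior does. *)
Require Import Defs.
From HB Require Import structures.
From mathcomp Require Import all_boot all_order all_algebra.
From mathcomp Require Import all_classical all_reals all_analysis.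
From mathcomp Require Import ring measurable_realfun.

Import Order.TTheory GRing.Theory Num.Theory.
Import numFieldNormedType.Exports.

Local Open Scope classical_set_scope.
Local Open Scope ring_scope.

(** The constant [Z^-1] leaves the integral, and what remains is the marginal likelihood itself. Its
    bounds enter twice: finiteness makes [fine] faithful, positivity makes [Z] invertible. *)
Lemma integral_posterior (R : realType) (d : measure_display)
    (W : measurableType d) (mu : {measure set W -> \bar R})
    (prior lik : W -> R) :
  measurable_fun setT prior -> (forall w, 0 <= prior w) ->
  measurable_fun setT lik -> (forall w, 0 <= lik w) ->
  (0 < marginal_likelihood mu prior lik < +oo)%E ->
  (\int[mu]_w (posterior mu prior lik w)%:E = 1)%E.
Proof.
move=> mp p0 ml l0 /andP[Z_gt0 Z_fin].
have ZE : (fine (marginal_likelihood mu prior lik))%:E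
    = marginal_likelihood mu prior lik.
  by rewrite fineK// gt0_fin_numE.
have fZ_gt0 : 0 < fine (marginal_likelihood mu prior lik).
  by apply: fine_gt0; rewrite Z_gt0.
rewrite /posterior; set Z := fine _ in ZE fZ_gt0 *.
under eq_integral do rewrite mulrC EFinM.
rewrite ge0_integralZl_EFin//.
- by rewrite -/(marginal_likelihood mu prior lik) -ZE -EFinM mulVf// gt_eqF.
- by move=> w _; rewrite lee_fin mulr_ge0.
- by apply/measurable_EFinP; apply: measurable_funM.
- by rewrite invr_ge0 ltW.
Qed.

Lemma integral_posterior_prior_gt0 (R : realType) (d : measure_display)
    (W : measurableType d) (mu : {measure set W -> \bar R})
    (prior lik : W -> R) :
  (forall w, 0 <= prior w) ->
  (\int[mu]_(w in [set w | (0 < prior w)%R]) (posterior mu prior lik w)%:E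
   = \int[mu]_w (posterior mu prior lik w)%:E)%E.
Proof.
(* Extending the restricted integrand by zero reduces the claim to a pointwise equality. *)
move=> p0; rewrite integral_mkcond; apply: eq_integral => w _.
rewrite patchE; case: ifPn => // wp.
have pw0 : prior w = 0.
  apply/eqP; move: wp; apply: contraNT => pw_neq0.
  by rewrite inE /= lt_neqAle eq_sym pw_neq0 p0.
by rewrite /posterior pw0 mulr0 mul0r.
Qed.

(** The priors are compared only at the point [w]: each normalizer keeps its own [local_prior c] and
    is carried along as a constant. *)
Lemma posterior_prod (R : realType) (d : measure_display)
    (W : measurableType d) (mu : {measure set W -> \bar R})
    (C : nat) (hC : (1 <= C)%N) (prior joint : W -> R)
    (local_prior lik : 'I_C -> W -> R) (w : W) :
  (forall c, 0 < fine (marginal_likelihood mu (local_prior c) (lik c))) ->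
  (forall c, local_prior c w = prior w) ->
  joint w = \prod_(c < C) lik c w ->
  0 < prior w ->
  posterior mu prior joint w =
  \prod_(c < C) fine (marginal_likelihood mu (local_prior c) (lik c))
    / fine (marginal_likelihood mu prior joint)
  * ((\prod_(c < C) posterior mu (local_prior c) (lik c) w)
     / prior w ^+ (C - 1)).
Proof.
move=> Zc_gt0 priorE jointE pw_gt0.
rewrite /posterior jointE; set Z := fine (marginal_likelihood mu prior joint).
have -> : \prod_(c < C) (lik c w * local_prior c w
      / fine (marginal_likelihood mu (local_prior c) (lik c)))
    = (\prod_(c < C) lik c w) * prior w ^+ C
      / \prod_(c < C) fine (marginal_likelihood mu (local_prior c) (lik c)).
  rewrite prodf_div big_split /=; congr (_ * _ / _).
  by under eq_bigr do rewrite priorE; rewrite prodr_const card_ord.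
set P := \prod_(c < C) fine _; set L := \prod_(c < C) lik c w.
have P_neq0 : P != 0 by rewrite gt_eqF// prodr_gt0.
(* Subtraction on [nat] truncates, so [hC] is what allows one factor [prior w] to be split off from
   the power [C]. *)
rewrite -[X in prior w ^+ X](subnK hC) exprD expr1.
have pw_neq0 : prior w ^+ (C - 1) != 0 by rewrite expf_neq0// gt_eqF.
(* [Z^-1] is a factor of both sides; once it is an opaque atom, [field] only asks that [P] and [q]
   be nonzero. *)
move: Z^-1 (prior w ^+ _) pw_neq0 => z q q_neq0.
by field; apply/andP.
Qed.

Theorem proposition3p1 (R : realType) (d : measure_display)
  (W : measurableType d) (mu : {measure set W -> \bar R})
  (Data : Type) (C : nat) (hC : (1 <= C)%N) (D : 'I_C -> Data)
  (lik : Data -> W -> R)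
  (joint_lik : ('I_C -> Data) -> W -> R)
  (local_prior : 'I_C -> W -> R) (prior : W -> R)
  (lik_ge0 : forall x w, 0 <= lik x w)
  (lik_meas : forall x, measurable_fun setT (lik x))
  (joint_ge0 : forall x w, 0 <= joint_lik x w)
  (joint_meas : forall x, measurable_fun setT (joint_lik x))
  (prior_density : is_density mu prior)
  (local_prior_density : forall c, is_density mu (local_prior c))
  (local_marginal_pos_fin : forall c,
     (0 < marginal_likelihood mu (local_prior c) (lik (D c)) < +oo)%E)
  (joint_marginal_pos_fin :
     (0 < marginal_likelihood mu prior (joint_lik D) < +oo)%E)
  (cond_indep : forall w, joint_lik D w = \prod_(c < C) lik (D c) w)
  (same_prior : forall c w, local_prior c w = prior w) :
  exists alpha : R,
    (\int[mu]_(w in [set w | (0 < prior w)%R])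
       (alpha * ((\prod_(c < C) posterior mu (local_prior c) (lik (D c)) w)
                 / prior w ^+ (C - 1)))%R%:E = 1)%E /\
    forall w, 0 < prior w ->
      posterior mu prior (joint_lik D) w =
      alpha * ((\prod_(c < C) posterior mu (local_prior c) (lik (D c)) w)
               / prior w ^+ (C - 1)).
Proof.
have [prior_meas prior_ge0 _] := prior_density.
have Zc_gt0 c : 0 < fine (marginal_likelihood mu (local_prior c) (lik (D c))).
  exact/fine_gt0/local_marginal_pos_fin.
have E w : 0 < prior w -> _ := posterior_prod R d W mu C hC prior
  (joint_lik D) local_prior (fun c => lik (D c)) w Zc_gt0 (same_prior^~ w)
  (cond_indep w).
(* Unification with [E] fixes [alpha], so the pointwise identity is settled before the integral. *)
eexists; split; last exact: E.
(* The value 1 becomes the total mass of the global posterior, then its mass on [{prior > 0}], where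
   [E] identifies the integrands. *)
rewrite -(integral_posterior R d W mu prior (joint_lik D))//.
rewrite -integral_posterior_prior_gt0//.
by apply: eq_integral => w; rewrite inE /= => /E ->.
Qed.
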